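(* Let $b,c\in\mathbb{Z}$ and $d=b^2-4c$. For $n\in\mathbb{N}$ let $T_n(b,c)=\sum_{k=0}^{\lfloor n/2\rfloor}\binom n{2k}\binom{2k}k b^{n-2k}c^k$. (i) For every positive integer $n$, $$\sum_{k=0}^{n-1}T_k(b,c^2)(b-2c)^{n-1-k}\equiv0\pmod n\quad\text{and}\quad 6\sum_{k=0}^{n-1}kT_k(b,c^2)(b-2c)^{n-1-k}\equiv0\pmod n.$$ If $p$ is an odd prime not dividing $b-2c$, then $$\frac{2c}{p}\sum_{k=0}^{p-1}\frac{T_k(b,c^2)}{(b-2c)^k}\equiv -b+(b+2c)\left(\frac{b^2-4c^2}{p}\right)\pmod p$$ and $$\frac{12c^2}{p}\sum_{k=0}^{p-1}\frac{kT_k(b,c^2)}{(b-2c)^k}\equiv(b+2c)^2\left(1-\left(\frac{b^2-4c^2}{p}\right)\right)-4c^2\pmod p.$$ (ii) Suppose that $d=1$, i.e., there is $m\in\mathbb{Z}$ with $b=2m+1$ and $c=m^2+m$ (so that $T_k(b,c)=\sum_{j=0}^k\binom kj\binom{k+j}j m^j$). Then for all positive integers $n$, $$\frac1n\sum_{k=0}^{n-1}(2k+1)T_k(b,c)=\sum_{k=0}^{n-1}\binom n{k+1}\binom{n+k}k\left(\frac{b-1}2\right)^k\in\mathbb{Z}.$$ If $p$ is a prime not dividing $b-1=2m$, then $$\sum_{k=0}^{p-1}(2k+1)T_k(b,c)\equiv p+\frac{b+1}{b-1}\,p\left(\left(\frac{b+1}2\right)^{p-1}-1\right)\pmod{p^3}$$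 and $$\sum_{k=0}^{p-1}(2k+1)^2T_k(b,c)\equiv\frac{2}{b-1}\left(\frac{(1-b)/2}{p}\right)=\frac1m\left(\frac{-m}{p}\right)\pmod p.$$
   Context: $T_n(b,c)$ is the coefficient of $x^n$ in $(x^2+bx+c)^n$. $\left(\frac{\cdot}{p}\right)$ denotes the Legendre symbol. Congruences between rational numbers with denominators prime to the modulus are understood in the corresponding localized ring of integers. *)

(* Defs.v *)
From HB Require Import structures.
From mathcomp Require Import all_boot all_order all_algebra.

Set Implicit Arguments.
Unset Strict Implicit.
Unset Printing Implicit Defensive.

Import Order.TTheory GRing.Theory Num.Theory.
Local Open Scope ring_scope.

(* The agreement of this formula with the coefficient of 'X^n in
   ('X^2 + b 'X + c)^n is [T_coef] below. *)
Definition T (n : nat) (b c : int) : int :=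
  \sum_(0 <= k < n./2.+1)
     ('C(n, k.*2) * 'C(k.*2, k))%:R * b ^+ (n - k.*2) * c ^+ k.

(* The Legendre symbol (a / p); meaningful for p an odd prime. *)
Definition legendre (a : int) (p : nat) : int :=
  if (p %| a)%Z then 0
  else if [exists x : 'I_p, (p%:Z %| (x%:Z ^+ 2 - a))%Z] then 1 else -1.

(* Membership in the localization of the integers at the set of integers
   prime to M, as a subring of the rationals. *)
Definition loc_int (M : nat) (x : rat) : bool := coprimez (denq x) M.

(* Congruence modulo M in that localization; x and y are required to lie in
   it, so the relation also asserts the integrality of both sides. *)
Definition ratmod (M : nat) (x y : rat) : Prop :=
  [/\ loc_int M x, loc_int M y
    & exists2 z : rat, loc_int M z & x - y = M%:R * z].

Lemma sum_even (F : nat -> int) (n : nat) :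
  \sum_(0 <= k < n./2.+1) F k.*2 =
  \sum_(0 <= i < n.+1) if odd i then 0 else F i.
Proof.
elim: n => [|n IHn]; first by rewrite !big_nat1 double0.
rewrite [RHS]big_nat_recr //= -IHn uphalf_half.
case: (boolP (odd n)) => on /=; last by rewrite addr0.
rewrite add1n big_nat_recr //=; congr (_ + F _).
by rewrite doubleS -[in RHS](odd_double_half n) on.
Qed.

Lemma coef_X2DC_exp (c : int) (i : nat) :
  (('X^2 + c%:P) ^+ i)`_i =
  if odd i then 0 else ('C(i, i./2))%:R * c ^+ i./2.
Proof.
rewrite addrC exprDn coef_sum.
have coefk (k : nat) :
    (c%:P ^+ (i - k) * 'X^2 ^+ k *+ 'C(i, k))`_i =
    if (i == k.*2)%N then ('C(i, i./2))%:R * c ^+ i./2 else 0.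
  rewrite coefMn -rmorphXn /= coefCM -exprM coefXn mul2n.
  case: eqP => [->|_]; last by rewrite mulr0 mul0rn.
  by rewrite doubleK -addnn addnK mulr1 mulr_natl.
under eq_bigr => k _ do rewrite coefk.
case: (boolP (odd i)) => oi.
  by apply: big1 => k _; case: eqP oi => // ->; rewrite odd_double.
have ei : i./2.*2 = i by rewrite even_halfK.
have hi : (i./2 < i.+1)%N by rewrite ltnS -{2}ei -addnn leq_addl.
rewrite (bigD1 (Ordinal hi)) //= ei eqxx big1 ?addr0 // => k nk.
case: eqP => // ik; case/eqP: nk; apply: val_inj => /=.
by rewrite -[LHS]doubleK -ik.
Qed.

Lemma T_coef (n : nat) (b c : int) :
  T n b c = (('X^2 + b *: 'X + c%:P) ^+ n)`_n.
Proof.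
rewrite addrAC addrC [RHS in _ = RHS](_ : _ =
   \sum_(i < n.+1) if odd i then 0
     else ('C(n, i) * 'C(i, i./2))%:R * b ^+ (n - i) * c ^+ i./2).
  rewrite -(big_mkord xpredT (fun i => if odd i then 0 else
     ('C(n, i) * 'C(i, i./2))%:R * b ^+ (n - i) * c ^+ i./2)) -sum_even.
  by apply: eq_bigr => k _; rewrite doubleK.
rewrite exprDn coef_sum; apply: eq_bigr => i _.
have le_in : (i <= n)%N by rewrite -ltnS.
rewrite coefMn exprZn -scalerAl coefZ coefXnM ltnNge leq_subr /= subKn //.
rewrite coef_X2DC_exp; case: (odd i); first by rewrite mulr0 mul0rn.
by rewrite -[LHS]mulr_natl natrM -!mulrA; congr (_ * _); rewrite mulrCA.
Qed.

(* Main.v *)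
Require Import Defs.
From mathcomp Require Import all_boot all_order all_algebra finfield.
From mathcomp Require Import ring zify.
Import Order.TTheory GRing.Theory Num.Theory.
Local Open Scope ring_scope.

(* Part (i).  With u = b - 2c, expanding (u X + (X + c)^2)^k gives
   T_k(b,c^2) = sum_j C(k,j) C(2j,j) c^j u^(k-j).  Summing over k turns C(k,j)
   into C(n,j+1), and n divides C(n,j+1) C(2j,j) = n C(n-1,j) Cat_j; likewise
   j+2 divides 6 C(2j,j) for the weighted sum.  For n = p, the sum divided by p
   is evaluated in F_p with C(p-1,j) = (-1)^j, C(2j,j) = C((p-1)/2,j) (-4)^j and
   Cat_j = 2 C((p+1)/2,j+1) (-4)^j for j < p-1, while Cat_(p-1) = -1; the binomial
   theorem produces ((b+2c)/u)^((p-1)/2), a Legendre symbol by Euler's criterion.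

   Part (ii).  If d = 1 then X^2 + bX + c = (X+m)(X+m+1), whence the formula for
   T_k.  The first sum telescopes coefficientwise; modulo p^2 the factors C(p+k,k)
   become 1 (for k = p-1 this is Babbage's congruence), leaving ((m+1)^p - 1)/m.
   The last sum telescopes as well, and modulo p only the coefficient of
   m^((p-3)/2) survives. *)

(** * Fermat's little theorem and Euler's criterion in ['F_p] *)

Lemma intr_Fp_eq0 (p : nat) (p_pr : prime p) (a : int) :
  (a%:~R == 0 :> 'F_p) = (p %| a)%Z.
Proof. by rewrite (dvdz_pcharf (pchar_Fp p_pr)). Qed.

Lemma natr_Fp_neq0 (p : nat) (p_pr : prime p) (j : nat) :
  (0 < j < p)%N -> j%:R != 0 :> 'F_p.
Proof.
case/andP=> j0 jp; rewrite -(dvdn_pcharf (pchar_Fp p_pr)).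
by apply: contraTN jp => /(dvdn_leq j0); rewrite -leqNgt.
Qed.

Lemma expf_Fp (p : nat) (p_pr : prime p) (x : 'F_p) : x ^+ p = x.
Proof. by have := expf_card x; rewrite card_Fp. Qed.

Lemma expf_Fp_pred (p : nat) (p_pr : prime p) (x : 'F_p) :
  x != 0 -> x ^+ p.-1 = 1.
Proof.
move=> x0; apply: (mulfI x0); rewrite mulr1 -exprS prednK ?expf_Fp //.
exact: prime_gt0.
Qed.

(* If a non-square had a ^ ((p-1)/2) = 1, then 'X^((p-1)/2) - 1 would have that
   root in addition to the (p-1)/2 squares i^2. *)
Lemma legendre_Euler (p : nat) (p_pr : prime p) (p_odd : odd p) (a : int) :
  (legendre a p)%:~R = a%:~R ^+ p./2 :> 'F_p.
Proof.
have p2 : p.-1 = (p./2).*2 by have := odd_double_half p; rewrite p_odd; lia.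
have n0 : (0 < p./2)%N by have := prime_gt1 p_pr; lia.
rewrite /legendre -intr_Fp_eq0 //; case: ifPn => [/eqP->|a0].
  by rewrite expr0n; case: (p./2) n0.
case: ifPn => [/existsP[x]|].
  rewrite -intr_Fp_eq0 // rmorphB rmorphXn /= subr_eq0 => /eqP ax.
  rewrite -ax -exprM mul2n -p2 expf_Fp_pred //.
  by apply: contraNneq a0 => x0; rewrite -ax x0 expr0n.
rewrite negb_exists => /forallP nsq.
have : (a%:~R ^+ p./2 == 1 :> 'F_p) || (a%:~R ^+ p./2 == -1 :> 'F_p).
  by rewrite -eqf_sqr expr1n -exprM muln2 -p2 expf_Fp_pred.
case/orP=> /eqP an; last by rewrite an rmorphN.
pose s : seq 'F_p := a%:~R :: [seq (i%:R : 'F_p) ^+ 2 | i <- iota 1 p./2].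
have pol : 'X^(p./2) - 1 != 0 :> {poly 'F_p}.
  by rewrite -size_poly_eq0 size_XnsubC.
have abs := @max_poly_roots _ _ s pol.
rewrite size_XnsubC //= size_map size_iota ltnn in abs.
suff [alls us] : all (root ('X^(p./2) - 1)) s /\ uniq s by have := abs alls us.
split.
  rewrite /s /=; apply/andP; split.
    by rewrite /root !hornerE an subrr.
  apply/allP => y /mapP[i]; rewrite mem_iota => hi ->.
  rewrite /root !hornerE -exprM mul2n -p2 expf_Fp_pred ?subrr //.
  by apply: natr_Fp_neq0 => //; lia.
rewrite /s /= map_inj_in_uniq ?iota_uniq ?andbT.
  apply/mapP => -[i]; rewrite mem_iota => hi ai.
  have ip : (i < p)%N by lia.
  have := nsq (Ordinal ip); rewrite -intr_Fp_eq0 // rmorphB rmorphXn /=.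
  by rewrite ai subrr eqxx.
move=> i j; rewrite !mem_iota => hi hj.
wlog ij : i j hi hj / (i <= j)%N.
  by move=> H; case: (leqP i j) => [|/ltnW] ij E; [|apply/esym]; apply: H.
move/eqP; rewrite eqf_sqr.
case/orP=> [|]; last first.
  rewrite -subr_eq0 opprK -natrD => ij0.
  by have /negP[] : (i + j)%:R != 0 :> 'F_p by apply: natr_Fp_neq0 => //; lia.
rewrite eq_sym -subr_eq0 -natrB // -(dvdn_pcharf (pchar_Fp p_pr)).
case: (posnP (j - i)) => [|d0 /(dvdn_leq d0)]; lia.
Qed.

(** * Binomial coefficients and Catalan numbers modulo p *)

(** Coefficients of (1+X)^(p+r) = (1+X^p)(1+X)^r in characteristic p. Pascal's rule carries the
    identity from r to r+1; r = 0 is p | C(p,k) for 0 < k < p. *)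
Lemma bin_addp_Fp (p : nat) (p_pr : prime p) (r k : nat) :
  'C(p + r, k)%:R =
  'C(r, k)%:R + (if (p <= k)%N then 'C(r, k - p)%:R else 0) :> 'F_p.
Proof.
have p0 := prime_gt0 p_pr.
elim: r k => [|r IHr] k.
  rewrite addn0; case: (ltngtP k p) => [kp|pk|->]; last first.
  - by rewrite binn subnn bin0 bin0n; case: p p0 {p_pr} => //= *; rewrite add0r.
  - rewrite bin_small // !bin0n subn_eq0 leqNgt pk.
    by case: k pk => //= *; rewrite addr0.
  case: k kp => [|k] kp; first by rewrite !bin0 addr0.
  rewrite bin0n addr0; apply/eqP.
  by rewrite -(dvdn_pcharf (pchar_Fp p_pr)) prime_dvd_bin.
case: k => [|k]; first by rewrite !bin0 leqNgt p0 addr0.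
rewrite addnS !binS natrD !IHr natrD.
case: (ltngtP p k.+1) => pk.
- have pk' : (p <= k)%N by [].
  by rewrite pk' subSn // binS natrD; ring.
- have pk' : (p <= k)%N = false by lia.
  by rewrite pk'; ring.
have pk' : (p <= k)%N = false by lia.
by rewrite pk' -pk subnn !bin0; ring.
Qed.

(** C(p,j+1) = 0 for j+1 < p, so by Pascal's rule consecutive entries of row p-1 are opposite. *)
Lemma bin_predp_Fp (p : nat) (p_pr : prime p) (j : nat) :
  (j < p)%N -> 'C(p.-1, j)%:R = (-1) ^+ j :> 'F_p.
Proof.
elim: j => [|j IHj] jp; first by rewrite bin0.
have := bin_addp_Fp p p_pr 0 j.+1.
rewrite addn0 bin0n leqNgt jp /= addr0 => h0.
move: h0; rewrite -[in 'C(p, _)](prednK (prime_gt0 p_pr)) binS natrD.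
rewrite (IHj (ltnW jp)) => /eqP; rewrite addr_eq0 => /eqP->.
by rewrite exprS mulN1r.
Qed.

Lemma mul_bin_leftr (R : pzRingType) (n m : nat) :
  m.+1%:R * 'C(n, m.+1)%:R = (n%:R - m%:R) * 'C(n, m)%:R :> R.
Proof.
rewrite -natrM mul_bin_left natrM.
case: (leqP m n) => mn; first by rewrite natrB.
by rewrite bin_small // !mulr0.
Qed.

Lemma mul_bin_diagr (R : pzRingType) (n m : nat) :
  m.+1%:R * 'C(n.+1, m.+1)%:R = n.+1%:R * 'C(n, m)%:R :> R.
Proof. by rewrite -!natrM -mul_bin_diag. Qed.

(** A difference of binomials instead of C(2j,j)/(j+1), so that it can be reduced modulo p even when
    p divides j+1. *)
Definition catalan (j : nat) : nat := 'C(j.*2, j) - 'C(j.*2, j.+1).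

Lemma bin_central_succ_le (j : nat) : ('C(j.*2, j.+1) <= 'C(j.*2, j))%N.
Proof.
rewrite -(leq_pmul2l (ltn0Sn j)) mul_bin_left.
by rewrite leq_mul2r -addnn addnK leqnSn orbT.
Qed.

Lemma mul_catalan (j : nat) : (j.+1 * catalan j = 'C(j.*2, j))%N.
Proof.
rewrite /catalan mulnBr mul_bin_left -addnn addnK mulSn; lia.
Qed.

Lemma bin_central_rec (j : nat) :
  (j.+1 * 'C(j.+1.*2, j.+1) = 2 * (j.*2.+1) * 'C(j.*2, j))%N.
Proof.
rewrite doubleS -mul_bin_diag /=.
have -> : 'C(j.*2.+1, j) = 'C(j.*2.+1, j.+1).
  by rewrite -bin_sub; [congr binomial|]; lia.
have -> : j.*2.+2 = (2 * j.+1)%N by lia.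
by rewrite -mulnA -mul_bin_diag /=; lia.
Qed.

(** Modulo p, (p-1)/2 is -1/2, and C(2j,j) = C(-1/2,j) (-4)^j. Both sides obey the same first-order
    recurrence in j, whose leading factor j+1 is invertible for j+1 < p. *)
Lemma bin_central_Fp (p : nat) (p_pr : prime p) (p_odd : odd p) (j : nat) :
  (j < p)%N -> 'C(j.*2, j)%:R = 'C(p./2, j)%:R * (-4) ^+ j :> 'F_p.
Proof.
have hn : p./2.*2.+1%:R = 0 :> 'F_p.
  apply/eqP; rewrite -(dvdn_pcharf (pchar_Fp p_pr)).
  by have := odd_double_half p; rewrite p_odd add1n => ->.
elim: j => [|j IHj] jp; first by rewrite !bin0 mulr1.
have j0 : j.+1%:R != 0 :> 'F_p by apply: natr_Fp_neq0.
apply: (mulfI j0); rewrite mulrA [in RHS]mul_bin_leftr -natrM bin_central_rec.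
rewrite !natrM IHj ?(ltnW jp) // exprS.
move: hn; rewrite -[p./2.*2.+1]addn1 natrD -mul2n natrM.
rewrite -[j.*2.+1]addn1 natrD -mul2n natrM => hn.
have -> : (p./2%:R - j%:R) * 'C(p./2, j)%:R * (-4 * (-4) ^+ j) =
   (2 * (2 * j%:R + 1) - 2 * (2 * p./2%:R + 1)) * 
   ('C(p./2, j)%:R * (-4) ^+ j) :> 'F_p by ring.
by rewrite hn mulr0 subr0.
Qed.

Lemma bin_central_Fp_eq0 (p : nat) (p_pr : prime p) (j : nat) :
  (j < p <= j.*2)%N -> 'C(j.*2, j)%:R = 0 :> 'F_p.
Proof.
case/andP=> jp pj; rewrite -(subnKC pj) bin_addp_Fp //.
by rewrite leqNgt jp bin_small ?addr0 //; lia.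
Qed.

(** Divides [bin_central_Fp] by j+1: absorption turns (j+1) C((p+1)/2, j+1) into (p+1)/2 times
    C((p-1)/2, j), and p+1 = 1 in ['F_p]. *)
Lemma catalan_Fp (p : nat) (p_pr : prime p) (p_odd : odd p) (j : nat) :
  (j < p.-1)%N ->
  (catalan j)%:R = 2 * 'C(p./2.+1, j.+1)%:R * (-4) ^+ j :> 'F_p.
Proof.
move=> jp; have hn : 2 * p./2.+1%:R = 1 :> 'F_p.
  have -> : 2 * p./2.+1%:R = p%:R + 1 :> 'F_p.
    rewrite -natrM natr1; congr _%:R.
    by have := odd_double_half p; rewrite p_odd; lia.
  by rewrite pchar_Fp_0 // add0r.
have j0 : j.+1%:R != 0 :> 'F_p by apply: natr_Fp_neq0; lia.
apply: (mulfI j0); rewrite -[LHS]natrM mul_catalan bin_central_Fp //; last lia.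
have -> : j.+1%:R * (2 * 'C(p./2.+1, j.+1)%:R * (-4) ^+ j) =
   2 * (j.+1%:R * 'C(p./2.+1, j.+1)%:R) * (-4) ^+ j :> 'F_p by ring.
by rewrite mul_bin_diagr mulrA hn mul1r.
Qed.

(** Here j+1 = p is not invertible, so the defining difference is reduced: with 2p-2 = p + (p-2),
    C(2p-2,p-1) becomes 0 and C(2p-2,p) becomes 1. *)
Lemma catalan_predp_Fp (p : nat) (p_pr : prime p) :
  (catalan p.-1)%:R = -1 :> 'F_p.
Proof.
have p1 := prime_gt1 p_pr.
rewrite /catalan natrB ?bin_central_succ_le //.
have -> : (p.-1).*2 = (p + p.-2)%N by lia.
rewrite !bin_addp_Fp // prednK ?leqnn ?subnn ?bin0; last lia.
rewrite leqNgt ltn_predL (ltnW p1) /= !bin_small //; try lia.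
by ring.
Qed.

(** * Closed forms in ['F_p] for the sums of part (i) *)

Lemma sum_bin_expr (R : comPzRingType) (n N : nat) (y : R) :
  (n < N)%N -> \sum_(0 <= j < N) 'C(n, j)%:R * y ^+ j = (1 + y) ^+ n.
Proof.
move=> nN; rewrite exprDn -(big_mkord xpredT
  (fun i => 1 ^+ (n - i) * y ^+ i *+ 'C(n, i))) /=.
rewrite (@big_cat_nat _ _ _ n.+1) //= [X in _ + X]big_nat [X in _ + X]big1
  ?addr0 => [|i].
  by apply: eq_bigr => i _; rewrite expr1n mul1r mulr_natl.
by case/andP=> ni _; rewrite bin_small // mul0r.
Qed.

Lemma big_nat_recr_pred (V : nmodType) (n : nat) (F : nat -> V) :
  (0 < n)%N -> \sum_(0 <= j < n) F j = \sum_(0 <= j < n.-1) F j + F n.-1.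
Proof. by case: n => // n _; rewrite big_nat_recr. Qed.

(** Analogue in ['F_p] of the power series sum C(2j,j) x^j = (1-4x)^(-1/2), since (p-1)/2 = -1/2. *)
Lemma sum_bin_central_Fp (p : nat) (p_pr : prime p) (p_odd : odd p) (x : 'F_p) :
  \sum_(0 <= j < p.-1) 'C(j.*2, j)%:R * x ^+ j = (1 - 4 * x) ^+ p./2.
Proof.
have p1 := prime_gt1 p_pr.
have p2 := odd_double_half p; rewrite p_odd in p2.
rewrite -mulNr -(sum_bin_expr _ _ p.-1); last lia.
rewrite !big_nat; apply: eq_bigr => j /andP[_ jp].
by rewrite bin_central_Fp ?exprMn ?mulrA //; lia.
Qed.

(** Analogue of 2x sum Cat_j x^j = 1 - (1-4x)^(1/2), since (p+1)/2 = 1/2. The range stops before j =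
    p-1, where the formula of [catalan_Fp] fails. *)
Lemma sum_catalan_Fp (p : nat) (p_pr : prime p) (p_odd : odd p) (x : 'F_p) :
  2 * x * (\sum_(0 <= j < p.-1) (catalan j)%:R * x ^+ j) =
  1 - (1 - 4 * x) ^+ p./2.+1.
Proof.
have p1 := prime_gt1 p_pr.
have p2 := odd_double_half p; rewrite p_odd in p2.
have two0 : 2 != 0 :> 'F_p by apply: natr_Fp_neq0 => //; lia.
rewrite -mulNr -(sum_bin_expr _ _ p.-1.+1); last lia.
rewrite big_nat_recl // bin0 mul1r.
rewrite expr0 opprD addNKr mulr_sumr -sumrN !big_nat.
apply: eq_bigr => j /andP[_ jp].
by rewrite catalan_Fp // exprMn !exprS; ring.
Qed.

(** The sign is split off because it will cancel against C(p-1,j) = (-1)^j. *)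
Lemma expf_div_Fp (p : nat) (p_pr : prime p) (c u : 'F_p) (j : nat) :
  u != 0 -> (j < p)%N -> c ^+ j * u ^+ (p.-1 - j) = (-1) ^+ j * (- c / u) ^+ j.
Proof.
move=> u0 jp; have p0 := prime_gt0 p_pr.
have uj : u ^+ j != 0 by rewrite expf_neq0.
rewrite -exprMn mulN1r mulNr opprK expr_div_n; apply: (mulIf uj).
rewrite mulfVK // -mulrA -exprD subnK; last lia.
by rewrite expf_Fp_pred // mulr1.
Qed.

(** For u = b - 2c the base on the left is b^2 - 4c^2. It equals (1 - 4x) u^2 with x = -c/u, and
    (u^2)^((p-1)/2) = 1. *)
Lemma expf_half_Fp (p : nat) (p_pr : prime p) (p_odd : odd p) (c u : 'F_p) :
  u != 0 -> ((u + 4 * c) * u) ^+ p./2 = (1 - 4 * (- c / u)) ^+ p./2.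
Proof.
move=> u0; have p2 : p.-1 = (p./2).*2.
  by have := odd_double_half p; rewrite p_odd; lia.
have -> : (u + 4 * c) * u = (1 - 4 * (- c / u)) * u ^+ 2 by field.
by rewrite exprMn -exprM mul2n -p2 expf_Fp_pred // mulr1.
Qed.

(** The first congruence of (i), with u = b - 2c, u + 2c = b and u + 4c = b + 2c. *)
Lemma sum_bin_catalan_Fp (p : nat) (p_pr : prime p) (p_odd : odd p)
    (c u : 'F_p) : u != 0 ->
  2 * c * (\sum_(0 <= j < p)
      ('C(p.-1, j) * catalan j)%:R * (c ^+ j * u ^+ (p.-1 - j))) =
  - (u + 2 * c) + (u + 4 * c) * ((u + 4 * c) * u) ^+ p./2.
Proof.
move=> u0; have p0 := prime_gt0 p_pr.
rewrite expf_half_Fp //; set x := - c / u.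
have cE : c = - (u * x) by rewrite /x; field.
(* The signs cancel; the term j = p-1 is -x^(p-1) because Cat_(p-1) = -1. *)
have -> : \sum_(0 <= j < p)
      ('C(p.-1, j) * catalan j)%:R * (c ^+ j * u ^+ (p.-1 - j)) =
    \sum_(0 <= j < p.-1) (catalan j)%:R * x ^+ j - x ^+ p.-1.
  rewrite (@eq_big_nat _ _ _ 0 p _
     (fun j => (catalan j)%:R * x ^+ j)) => [|j /andP[_ jp]].
    by rewrite big_nat_recr_pred // catalan_predp_Fp // mulN1r.
  rewrite expf_div_Fp // -/x natrM bin_predp_Fp //.
  by rewrite mulrCA !mulrA -exprMn mulrNN mulr1 expr1n mul1r.
set G := \sum_(_ <= _ < _) _.
have hG : 2 * x * G = 1 - (1 - 4 * x) * (1 - 4 * x) ^+ p./2.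
  by rewrite sum_catalan_Fp // exprS.
(* Kept with the extra factor x so that it also holds for x = 0, that is c = 0. *)
have hx : x * x ^+ p.-1 = x by rewrite -exprS prednK // expf_Fp.
have -> : 2 * c * (G - x ^+ p.-1) = - u * (2 * x * G) + 2 * u * (x * x ^+ p.-1).
  by rewrite cE; ring.
by rewrite hG hx cE; ring.
Qed.

(* Equal to 6 C(2j,j) / (j+2), in a form that makes its integrality visible. *)
Definition central_quo (j : nat) : int :=
  4 * 'C(j.*2, j)%:R - (j.+1 * catalan j.+1)%:R.

(** (j+1)(j+2) Cat_(j+1) = 2(2j+1) C(2j,j), and 4(j+2) - 2(2j+1) = 6. *)
Lemma mul_central_quo (j : nat) :
  j.+2%:R * central_quo j = 6 * 'C(j.*2, j)%:R.
Proof.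
have h1 : (j.+1 * (j.+2 * catalan j.+1) = 2 * (j.*2.+1) * 'C(j.*2, j))%N.
  by rewrite mul_catalan bin_central_rec.
rewrite /central_quo; lia.
Qed.

(** The second congruence of (i), again with u = b - 2c. The sum reduces to F, G and their shifts by
    one index, all known in closed form. *)
Lemma sum_bin_central_quo_Fp (p : nat) (p_pr : prime p) (p_odd : odd p)
    (c u : 'F_p) : u != 0 ->
  2 * c ^+ 2 * (\sum_(0 <= j < p)
      ('C(p.-1, j.+1)%:R * j.+1%:R * (central_quo j)%:~R
         + 6 * j%:R * 'C(p.-1, j)%:R * (catalan j)%:R)
      * (c ^+ j * u ^+ (p.-1 - j))) =
  (u + 4 * c) ^+ 2 * (1 - ((u + 4 * c) * u) ^+ p./2) - 4 * c ^+ 2.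
Proof.
move=> u0; have p0 := prime_gt0 p_pr; have p1 := prime_gt1 p_pr.
rewrite expf_half_Fp //; set x := - c / u.
have cE : c = - (u * x) by rewrite /x; field.
(* At j = p-1 the first summand has C(p-1,p) = 0; the second gives 6 x^(p-1). *)
rewrite big_nat_recr_pred //.
rewrite prednK // (@bin_small p.-1 p) ?ltn_predL // !mul0r add0r expf_div_Fp //; last lia.
rewrite -/x binn catalan_predp_Fp //.
have sgn : (-1) ^+ p.-1 = 1 :> 'F_p.
  by rewrite -signr_odd; case: p p_odd {p_pr c u u0 x cE p0 p1} => //= p /negbTE->.
have pm1 : p.-1%:R = -1 :> 'F_p.
  by apply/eqP; rewrite -addr_eq0 natr1 prednK // pchar_Fp_0.
rewrite sgn pm1.
pose F := \sum_(0 <= j < p.-1) 'C(j.*2, j)%:R * x ^+ j.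
pose G := \sum_(0 <= j < p.-1) (catalan j)%:R * x ^+ j.
have hF : F = (1 - 4 * x) ^+ p./2 by apply: sum_bin_central_Fp.
have hG : 2 * x * G = 1 - (1 - 4 * x) * (1 - 4 * x) ^+ p./2.
  by rewrite sum_catalan_Fp // exprS.
have hx : x * x ^+ p.-1 = x by rewrite -exprS prednK // expf_Fp.
(* Shifting brings in the term j = p-1: it is 0 for F and will be -x^(p-1) for G. *)
have hF1 : x * (\sum_(0 <= j < p.-1) 'C(j.+1.*2, j.+1)%:R * x ^+ j) = F - 1.
  have : \sum_(0 <= j < p.-1.+1) 'C(j.*2, j)%:R * x ^+ j = F.
    rewrite big_nat_recr //= bin_central_Fp_eq0 //; last lia.
    by rewrite mul0r addr0.
  rewrite big_nat_recl // bin0 expr0 mulr1 => <-; rewrite addrAC subrr add0r.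
  by rewrite mulr_sumr; apply: eq_bigr => j _; rewrite exprS mulrCA.
have hG1 : x * (\sum_(0 <= j < p.-1) (catalan j.+1)%:R * x ^+ j) =
           G - x ^+ p.-1 - 1.
  have : \sum_(0 <= j < p.-1.+1) (catalan j)%:R * x ^+ j = G - x ^+ p.-1.
    by rewrite big_nat_recr //= catalan_predp_Fp // mulN1r.
  rewrite big_nat_recl // [catalan 0]/= expr0 mulr1 => <-.
  rewrite addrAC subrr add0r.
  by rewrite mulr_sumr; apply: eq_bigr => j _; rewrite exprS mulrCA.
set S := \sum_(_ <= _ < _) _.
(* For j < p-1 the coefficient of x^j is 6j Cat_j - (j+1) q with q = [central_quo j]. From (j+1)
   Cat_j = C(2j,j) and (j+2) q = 6 C(2j,j) it equals q - 6 Cat_j, and q = 4 C(2j,j) - C(2j+2,j+1) +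
   Cat_(j+1). *)
have hS : S = 4 * F - \sum_(0 <= j < p.-1) 'C(j.+1.*2, j.+1)%:R * x ^+ j
   + \sum_(0 <= j < p.-1) (catalan j.+1)%:R * x ^+ j - 6 * G.
  rewrite !mulr_sumr -sumrB -big_split -sumrB /= /S !big_nat.
  apply: eq_bigr => j /andP[_ jp].
  have jp1 : (j.+1 < p)%N by lia.
  rewrite expf_div_Fp -/x ?bin_predp_Fp ?(ltnW jp1) // exprS.
  have hq : (central_quo j)%:~R =
     4 * 'C(j.*2, j)%:R - j.+1%:R * (catalan j.+1)%:R :> 'F_p.
    by rewrite /central_quo natrM rmorphB !rmorphM /= !rmorph_nat.
  have h1 : (j.+1%:R + 1) * (catalan j.+1)%:R = 'C(j.+1.*2, j.+1)%:R :> 'F_p.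
    by rewrite natr1 -natrM mul_catalan.
  have h2 : (j%:R + 1) * (catalan j)%:R = 'C(j.*2, j)%:R :> 'F_p.
    by rewrite natr1 -natrM mul_catalan.
  have h3 : (j.+1%:R + 1) * (central_quo j)%:~R = 6 * 'C(j.*2, j)%:R :> 'F_p.
    rewrite natr1.
    have := congr1 (fun z : int => z%:~R : 'F_p) (mul_central_quo j).
    by rewrite /= !rmorphM /= !rmorph_nat.
  have sq : (-1) ^+ j * (-1) ^+ j = 1 :> 'F_p by rewrite -exprMn mulrNN mulr1 expr1n.
  transitivity ((6 * ((j%:R + 1) * (catalan j)%:R) - 6 * (catalan j)%:R
     - (j.+1%:R + 1) * (central_quo j)%:~R + (central_quo j)%:~R)
     * ((-1) ^+ j * (-1) ^+ j) * x ^+ j); first by ring.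
  rewrite h2 h3 sq -h1 hq; ring.
(* Of the factor x^2 in c^2 = u^2 x^2, one x closes the shifted sums and the other closes G. *)
have -> : 2 * c ^+ 2 * (S + 6 * -1 * 1 * -1 * (1 * x ^+ p.-1)) =
   2 * u ^+ 2 * x * (x * S + 6 * (x * x ^+ p.-1)) by rewrite cE; ring.
have xS : x * S = 4 * x * F - (F - 1) + (G - x ^+ p.-1 - 1) - 6 * x * G.
  by rewrite hS -hF1 -hG1; ring.
have -> : 2 * u ^+ 2 * x * (x * S + 6 * (x * x ^+ p.-1)) =
   u ^+ 2 * (8 * x ^+ 2 * F - 2 * x * F + (2 * x * G) * (1 - 6 * x)
     - 2 * (x * x ^+ p.-1) + 12 * x * (x * x ^+ p.-1)) by rewrite xS; ring.
by rewrite hG hx hF cE; ring.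
Qed.

(** * Congruences between fractions *)

(** The fraction need not be reduced: [denq x] divides [numq x * v] and is prime to [numq x], hence
    divides v. *)
Lemma loc_int_div (M : nat) (a v : int) :
  v != 0 -> coprimez v M -> loc_int M (a%:~R / v%:~R).
Proof.
move=> v0; rewrite /loc_int !coprimezE; set x : rat := _ / _.
apply: coprime_dvdl; rewrite -dvdzE.
have E : numq x * v = a * denq x.
  apply: (intr_inj (R := rat)); rewrite !rmorphM /= numqE /x; field.
  by rewrite intr_eq0.
have : (denq x %| numq x * v)%Z by rewrite E dvdz_mull.
by rewrite Gauss_dvdzr // coprimezE coprime_sym coprime_num_den.
Qed.

Lemma ratmod_div (M : nat) (a v e w : int) : (0 < M)%N ->
  v != 0 -> w != 0 -> coprimez v M -> coprimez w M ->
  (M %| a * w - e * v)%Z ->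
  ratmod M (a%:~R / v%:~R) (e%:~R / w%:~R).
Proof.
move=> M0 v0 w0 cv cw /dvdzP[q hq].
split; [exact: loc_int_div|exact: loc_int_div|].
exists (q%:~R / (v * w)%:~R).
  by apply: loc_int_div; rewrite ?mulf_neq0 // coprimezMl cv.
have : (a%:~R * w%:~R - e%:~R * v%:~R = q%:~R * M%:R :> rat).
  by rewrite -!rmorphM -rmorphB /= hq rmorphM.
rewrite rmorphM /= => hq'.
have v1 : v%:~R != 0 :> rat by rewrite intr_eq0.
have w1 : w%:~R != 0 :> rat by rewrite intr_eq0.
transitivity ((a%:~R * w%:~R - e%:~R * v%:~R) / (v%:~R * w%:~R) : rat).
  by field; rewrite v1 w1.
by rewrite hq'; field; rewrite v1 w1.
Qed.

Lemma ratmod_int (M : nat) (a e : int) : (0 < M)%N ->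
  (M %| a - e)%Z -> ratmod M a%:~R e%:~R.
Proof.
move=> M0 h; rewrite -[a%:~R]divr1 -[e%:~R]divr1 -[1]/(1%:~R).
by apply: ratmod_div; rewrite ?mulr1 // coprimezE coprime1n.
Qed.

(** * Expansions of [T] in binomial coefficients *)

(** Gives the expansions of all T_k a common range in j, so that the sums over k and j can be
    exchanged. *)
Lemma sum_nat_widen0 (V : nmodType) (n N : nat) (F : nat -> V) :
  (n <= N)%N -> (forall j, (n <= j)%N -> F j = 0) ->
  \sum_(0 <= j < n) F j = \sum_(0 <= j < N) F j.
Proof.
move=> nN F0; rewrite (@big_cat_nat _ _ _ n 0 N) //=.
rewrite [X in _ = _ + X]big_nat [X in _ = _ + X]big1 ?addr0 //.
by move=> j /andP[nj _]; apply: F0.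
Qed.

Lemma coef_XDC_exp (c : int) (n i : nat) :
  (('X + c%:P) ^+ n)`_i = 'C(n, i)%:R * c ^+ (n - i).
Proof.
rewrite addrC exprDn coef_sum.
under eq_bigr => k _ do
  rewrite coefMn -rmorphXn /= coefCM coefXn mulr_natr -mulrnA.
case: (ltnP i n.+1) => hi.
  rewrite (bigD1 (Ordinal hi)) //= eqxx mul1n big1 ?addr0 => [|k nk].
    by rewrite mulr_natl.
  rewrite (_ : (i == k) = false) ?mul0n ?mulr0n //.
  by apply: contraNF nk => /eqP ik; apply/eqP/val_inj.
rewrite bin_small // mul0r big1 // => k _.
rewrite (_ : (i == k) = false) ?mul0n ?mulr0n //.
by apply/eqP; have := ltn_ord k; lia.
Qed.

(* 'X^2 + b 'X + c^2 = (b - 2c) 'X + ('X + c)^2 *)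
Lemma T_sqE (k N : nat) (b c : int) : (k < N)%N ->
  T k b (c ^+ 2) = \sum_(0 <= j < N)
    ('C(k, j) * 'C(j.*2, j))%:R * (c ^+ j * (b - 2 * c) ^+ (k - j)).
Proof.
move=> kN; rewrite -(@sum_nat_widen0 _ k.+1) // => [|j kj]; last first.
  by rewrite bin_small // mul0n mul0r.
rewrite T_coef.
have -> : 'X^2 + b *: 'X + (c ^+ 2)%:P =
          (b - 2 * c) *: 'X + ('X + c%:P) ^+ 2 :> {poly int}.
  by rewrite -!mul_polyC rmorphXn rmorphB rmorphM /= rmorph_nat; ring.
rewrite exprDn coef_sum big_mkord; apply: eq_bigr => j _.
have jk : (j <= k)%N by rewrite -ltnS.
rewrite coefMn exprZn -scalerAl coefZ coefXnM ltnNge leq_subr /= subKn //.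
rewrite -exprM coef_XDC_exp mul2n -addnn addnK -mulr_natl natrM; ring.
Qed.

(* 'X^2 + (2m+1) 'X + m^2 + m = ('X + m) * (1 + ('X + m)) *)
Lemma T_disc1E (k N : nat) (m : int) : (k < N)%N ->
  T k (2 * m + 1) (m ^+ 2 + m) =
  \sum_(0 <= j < N) ('C(k, j) * 'C(k + j, j))%:R * m ^+ j.
Proof.
move=> kN; rewrite -(@sum_nat_widen0 _ k.+1) // => [|j kj]; last first.
  by rewrite bin_small // mul0n mul0r.
rewrite T_coef.
have -> : 'X^2 + (2 * m + 1) *: 'X + (m ^+ 2 + m)%:P =
          ('X + m%:P) * (1 + ('X + m%:P)) :> {poly int}.
  by rewrite -!mul_polyC !rmorphD rmorphXn rmorphM /= rmorph_nat rmorph1; ring.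
rewrite exprMn [(1 + _) ^+ k]exprDn mulr_sumr coef_sum big_mkord; apply: eq_bigr => j _.
rewrite expr1n mul1r -mulr_natr mulrA -exprD mulr_natr coefMn coef_XDC_exp.
rewrite -[in 'C(k + j, k)](@bin_sub (k + j) k) ?leq_addr // addKn.
by rewrite -[LHS]mulr_natl natrM mulrA.
Qed.

(** * Summation over k and divisibility by n *)

Lemma sum_bin_hockey (n j : nat) : (\sum_(0 <= k < n) 'C(k, j) = 'C(n, j.+1))%N.
Proof.
elim: n => [|n IHn]; first by rewrite big_geq.
by rewrite big_nat_recr //= IHn binS.
Qed.

Lemma sum_mul_bin_hockey (n j : nat) :
  (\sum_(0 <= k < n) k * 'C(k, j) = j.+1 * 'C(n, j.+2) + j * 'C(n, j.+1))%N.
Proof.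
elim: n => [|n IHn]; first by rewrite big_geq // !bin0n !muln0.
rewrite big_nat_recr //= IHn !(binS n) !mulnDr.
have := mul_bin_left n j.
case: (leqP j n) => jn; last by rewrite (@bin_small n j) // !muln0; lia.
by nia.
Qed.

Lemma mul_bin_central (n j : nat) :
  ('C(n.+1, j.+1) * 'C(j.*2, j) = n.+1 * ('C(n, j) * catalan j))%N.
Proof. by rewrite -mul_catalan mulnCA mulnA -mul_bin_diag -mulnA. Qed.

Lemma sum_T_sq (n : nat) (b c : int) :
  \sum_(0 <= k < n.+1) T k b (c ^+ 2) * (b - 2 * c) ^+ (n - k) =
  n.+1%:R * \sum_(0 <= j < n.+1)
     ('C(n, j) * catalan j)%:R * (c ^+ j * (b - 2 * c) ^+ (n - j)).
Proof.
set u := b - 2 * c.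
transitivity (\sum_(0 <= k < n.+1) \sum_(0 <= j < n.+1)
    ('C(k, j) * 'C(j.*2, j))%:R * (c ^+ j * u ^+ (n - j))).
  rewrite !big_nat; apply: eq_bigr => k /andP[_ kn].
  rewrite (T_sqE k n.+1) // mulr_suml; apply: eq_bigr => j _.
  (* For j > k the truncated exponent k - j is harmless because C(k,j) = 0. *)
  case: (leqP j k) => jk; last by rewrite bin_small // !mul0r.
  rewrite -/u -!mulrA -exprD; congr (_ * (_ * _ ^+ _)); lia.
rewrite exchange_big_nat mulr_sumr; apply: eq_bigr => j _.
rewrite -mulr_suml -natr_sum -big_distrl /= sum_bin_hockey mul_bin_central.
by rewrite natrM -mulrA.
Qed.

(** Summing k C(k,j) produces C(n+1,j+2) C(2j,j), where extracting n+1 costs a division by j+2. The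
    factor 6 pays for it: 6 C(2j,j) = (j+2) q with q = [central_quo j]. *)
Lemma sum_mul_T_sq (n : nat) (b c : int) :
  6 * (\sum_(0 <= k < n.+1) k%:R * T k b (c ^+ 2) * (b - 2 * c) ^+ (n - k)) =
  n.+1%:R * \sum_(0 <= j < n.+1)
     ('C(n, j.+1)%:R * j.+1%:R * central_quo j
        + 6 * j%:R * 'C(n, j)%:R * (catalan j)%:R)
     * (c ^+ j * (b - 2 * c) ^+ (n - j)).
Proof.
set u := b - 2 * c.
transitivity (6 * \sum_(0 <= k < n.+1) \sum_(0 <= j < n.+1)
    (k * 'C(k, j) * 'C(j.*2, j))%:R * (c ^+ j * u ^+ (n - j))).
  congr (6 * _).
  rewrite !big_nat; apply: eq_bigr => k /andP[_ kn].
  rewrite (T_sqE k n.+1) // mulr_sumr mulr_suml; apply: eq_bigr => j _.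
  case: (leqP j k) => jk; last by rewrite bin_small // muln0 !(mul0r, mulr0).
  rewrite -/u !natrM -!mulrA -exprD.
  congr (_ * (_ * (_ * (_ * _ ^+ _)))); lia.
rewrite exchange_big_nat !mulr_sumr; apply: eq_bigr => j _.
rewrite -mulr_suml -natr_sum -big_distrl /= sum_mul_bin_hockey.
rewrite !mulrA; congr (_ * _ * _).
have h1 := mul_bin_diagr int n j.
have h2 := mul_bin_diagr int n j.+1.
have h3 := mul_central_quo j.
have h4 : j.+1%:R * (catalan j)%:R = 'C(j.*2, j)%:R :> int.
  by rewrite -natrM mul_catalan.
rewrite natrM natrD !natrM.
transitivity (j.+1%:R * 'C(n.+1, j.+2)%:R * (6 * 'C(j.*2, j)%:R) +
   6 * j%:R * 'C(n.+1, j.+1)%:R * 'C(j.*2, j)%:R : int); first by ring.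
rewrite -h3 -h4.
transitivity (j.+1%:R * (j.+2%:R * 'C(n.+1, j.+2)%:R) * central_quo j +
   6 * j%:R * (j.+1%:R * 'C(n.+1, j.+1)%:R) * (catalan j)%:R : int).
  by ring.
by rewrite h1 h2; ring.
Qed.

(** The right side telescopes: since (n+1) C(n+1+j,j) = (n+1+j) C(n+j,j), its increment has the
    factor C(n+j,j), and what remains is linear in C(n,j) and C(n,j+1). *)
Lemma sum_odd_bin (n j : nat) :
  (\sum_(0 <= k < n) (2 * k + 1) * ('C(k, j) * 'C(k + j, j)) =
   n * ('C(n, j.+1) * 'C(n + j, j)))%N.
Proof.
elim: n => [|n IHn]; first by rewrite big_geq.
rewrite big_nat_recr //= IHn binS addSn.
have h1 : (n.+1 * 'C((n + j).+1, j) = (n + j).+1 * 'C(n + j, j))%N.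
  by rewrite (mul_bin_down (n + j).+1 j) -addSn addnK.
have h2 : (j.+1 * 'C(n, j.+1) + j * 'C(n, j) = n * 'C(n, j))%N.
  rewrite mul_bin_left; case: (leqP j n) => jn; first by nia.
  by rewrite bin_small // !muln0.
rewrite [RHS]mulnCA h1 !mulnA -mulnDl; congr (_ * _)%N.
move: h2; set x := 'C(n, j.+1); set y := 'C(n, j); nia.
Qed.

(** Both sides are (k+j)!/(j!^2 (k-j)!) when j <= k. On the right k occurs in one binomial only, so
    sums over k become hockey-stick sums. *)
Lemma bin_trinomial (k j : nat) :
  ('C(k, j) * 'C(k + j, j) = 'C(j.*2, j) * 'C(k + j, j.*2))%N.
Proof.
case: (leqP j k) => jk; last first.
  by rewrite (@bin_small k j) // (@bin_small (k + j) j.*2) ?mul0n ?muln0 //; lia.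
have h1 := bin_fact jk.
have h2 := bin_fact (leq_addl k j); rewrite addnK in h2.
have h3 : (j.*2 <= k + j)%N by lia.
have {}h3 := bin_fact h3.
have h4 : (j <= j.*2)%N by lia.
have {}h4 := bin_fact h4.
have e1 : (k + j - j.*2 = k - j)%N by lia.
have e2 : (j.*2 - j = j)%N by lia.
rewrite e1 in h3; rewrite e2 in h4.
have pos : (0 < j`! * j`! * (k - j)`!)%N by rewrite !muln_gt0 !fact_gt0.
apply/eqP; rewrite -(eqn_pmul2r pos); apply/eqP.
transitivity ('C(k + j, j) * (j`! * ('C(k, j) * (j`! * (k - j)`!))))%N.
  by ring.
transitivity ('C(k + j, j.*2) * ('C(j.*2, j) * (j`! * j`!) * (k - j)`!))%N.
  by rewrite h1 h4 h2 h3.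
by ring.
Qed.

(* From (2k+1)^2 = 4 (k-j)(k+j+1) + (2j+1)^2. *)
Lemma sum_sqr_odd_bin (n j : nat) :
  (\sum_(0 <= k < n) (2 * k + 1) ^ 2 * ('C(k, j) * 'C(k + j, j)) =
   'C(j.*2, j) * (4 * (j.*2.+2 * j.*2.+1) * 'C((n + j).+1, j.*2.+3)
     + j.*2.+1 ^ 2 * 'C(n + j, j.*2.+1)))%N.
Proof.
elim: n => [|n IHn].
  by rewrite big_geq // !(@bin_small _ _.+1) ?muln0 //; lia.
rewrite big_nat_recr // [LHS]/= IHn bin_trinomial.
have h1 := mul_bin_diagr int (n + j) j.*2.+1.
have h2 := mul_bin_leftr int (n + j) j.*2.
rewrite addSn (binS (n + j).+1) (binS (n + j) j.*2).
have e1 : (n + j).+1%:R = n%:R + j%:R + 1 :> int by rewrite -natr1 natrD.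
have e2 : j.*2%:R = 2 * j%:R :> int by rewrite -mul2n natrM.
have e3 : j.*2.+1%:R = 2 * j%:R + 1 :> int by rewrite -natr1 e2.
have e4 : j.*2.+2%:R = 2 * j%:R + 2 :> int by rewrite -addn2 natrD e2.
move: h1 h2; rewrite e1 e2 e3 e4 natrD.
move: 'C((n + j).+1, j.*2.+2) 'C((n + j).+1, j.*2.+3) 'C(n + j, j.*2.+1).
move: 'C(n + j, j.*2) 'C(j.*2, j) => C3 C4 C1 C5 C2 h1 h2.
apply/eqP; rewrite -(eqr_nat int); apply/eqP.
rewrite !(natrD, natrM, natrX) e3 e4.
(* Two absorptions give the increment of the first binomial, matching the 4(k-j)(k+j+1) part at k =
   n. *)
have key : 4 * ((2 * j%:R + 2) * (2 * j%:R + 1)) * C1%:R =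
           4 * (n%:R - j%:R) * (n%:R + j%:R + 1) * C3%:R :> int.
  transitivity (4 * (2 * j%:R + 1) * ((2 * j%:R + 2) * C1%:R) : int); first by ring.
  rewrite h1.
  transitivity (4 * (n%:R + j%:R + 1) * ((2 * j%:R + 1) * C2%:R) : int); first by ring.
  by rewrite h2; ring.
rewrite [RHS]mulrDr [4 * _ * (C5%:R + C1%:R)]mulrDr key; ring.
Qed.

Lemma sum_odd_T (n : nat) (m : int) :
  \sum_(0 <= k < n) (2 * k + 1)%:R * T k (2 * m + 1) (m ^+ 2 + m) =
  n%:R * \sum_(0 <= k < n) ('C(n, k.+1) * 'C(n + k, k))%:R * m ^+ k.
Proof.
transitivity (\sum_(0 <= k < n) \sum_(0 <= j < n)
   ((2 * k + 1) * ('C(k, j) * 'C(k + j, j)))%:R * m ^+ j).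
  rewrite !big_nat; apply: eq_bigr => k /andP[_ kn].
  rewrite (T_disc1E k n) // mulr_sumr; apply: eq_bigr => j _.
  by rewrite [in RHS]natrM mulrA.
rewrite exchange_big_nat mulr_sumr; apply: eq_bigr => j _.
by rewrite -mulr_suml -natr_sum sum_odd_bin natrM mulrA.
Qed.

(** * The sums of part (ii) modulo powers of p *)

Lemma sum_sqr_odd_T_Fp (p : nat) (p_pr : prime p) (p_odd : odd p) (m : int) :
  m%:~R * (\sum_(0 <= k < p)
     ((2 * k + 1) ^ 2)%:R * T k (2 * m + 1) (m ^+ 2 + m))%:~R
  = (- m)%:~R ^+ p./2 :> 'F_p.
Proof.
have p2 := odd_double_half p; rewrite p_odd in p2.
have p1 := prime_gt1 p_pr.
(* n = (p-3)/2, the index with 2n+3 = p. *)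
have [n pn] : exists n, p./2 = n.+1 by exists (p./2.-1); lia.
have -> : \sum_(0 <= k < p)
     ((2 * k + 1) ^ 2)%:R * T k (2 * m + 1) (m ^+ 2 + m) =
   \sum_(0 <= j < p) ('C(j.*2, j) *
     (4 * (j.*2.+2 * j.*2.+1) * 'C((p + j).+1, j.*2.+3)
     + j.*2.+1 ^ 2 * 'C(p + j, j.*2.+1)))%:R * m ^+ j.
  transitivity (\sum_(0 <= k < p) \sum_(0 <= j < p)
     ((2 * k + 1) ^ 2 * ('C(k, j) * 'C(k + j, j)))%:R * m ^+ j).
    rewrite !big_nat; apply: eq_bigr => k /andP[_ kp].
    rewrite (T_disc1E k p) // mulr_sumr; apply: eq_bigr => j _.
    by rewrite [in RHS]natrM mulrA.
  rewrite exchange_big_nat; apply: eq_bigr => j _.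
  by rewrite -mulr_suml -natr_sum sum_sqr_odd_bin.
have np : (n < p)%N by lia.
rewrite big_mkord (bigD1 (Ordinal np)) //= rmorphD /= [X in _ + X]rmorph_sum.
rewrite /= [X in _ + X]big1 ?addr0 => [|j nj].
  (* In ['F_p], C(p+n+1,p) = 1, C(p+n,p-2) = 0 and C(2n,n) = (n+1)(-4)^n; the constant is then
     settled by 2(n+1) = -1 and 4^(n+1) = 2^(p-1) = 1. *)
  rewrite rmorphM rmorphXn /= rmorph_nat -addnS.
  have e3 : n.*2.+3 = p by lia.
  rewrite e3 !(natrM, natrD, natrX) !bin_addp_Fp //.
  rewrite bin_central_Fp // pn leqnn subnn bin0 (@bin_small n.+1 p); last lia.
  rewrite binSn leqNgt (_ : (n.*2.+1 < p)%N); last lia.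
  rewrite (@bin_small n); last lia.
  have h0 : 2 * n.+1%:R = - 1 :> 'F_p.
    apply/eqP; rewrite -addr_eq0 -natrM natr1.
    rewrite (_ : (2 * n.+1).+1 = p); last lia.
    by rewrite pchar_Fp_0.
  have h1 : n.*2.+2%:R = -1 :> 'F_p by rewrite -h0 -natrM; congr _%:R; lia.
  have h2 : n.*2.+1%:R = -2 :> 'F_p.
    by apply: (addIr 1); rewrite natr1 h1; ring.
  have h4 : 4 ^+ n.+1 = 1 :> 'F_p.
    have -> : 4 = 2 ^+ 2 :> 'F_p by ring.
    rewrite -exprM (_ : (2 * n.+1)%N = p.-1); last lia.
    by apply: expf_Fp_pred => //; apply: natr_Fp_neq0 => //; lia.
  rewrite h1 h2.
  transitivity (- (2 * n.+1%:R) * 4 ^+ n.+1 * (- m%:~R) ^+ n.+1 : 'F_p).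
    rewrite -[-4]mulN1r -[- m%:~R]mulN1r !exprMn !exprS.
    by rewrite /=; ring.
  by rewrite h0 h4 opprK !mul1r rmorphN.
rewrite rmorphM rmorphXn /= rmorph_nat.
have jp := ltn_ord j.
suff -> : ('C(j.*2, j) *
     (4 * (j.*2.+2 * j.*2.+1) * 'C((p + j).+1, j.*2.+3)
     + j.*2.+1 ^ 2 * 'C(p + j, j.*2.+1)))%:R = 0 :> 'F_p by rewrite mul0r.
rewrite -addnS !(natrM, natrD, natrX).
have jn : (j != n :> nat) by apply: contraNneq nj => jn; apply/eqP/val_inj.
(* If 2j+1 < p, then 2j+3 < p by parity and j != n, and both large binomials vanish; if 2j+1 > p,
   C(2j,j) vanishes; if 2j+1 = p, that factor does. *)
case: (ltngtP j.*2.+1 p) => jlt.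
- rewrite !bin_addp_Fp //.
  rewrite !(@bin_small _ _.+1); try lia.
  rewrite (_ : (p <= j.*2.+3)%N = false); last lia.
  rewrite (_ : (p <= j.*2.+1)%N = false); last lia.
  by ring.
- by rewrite bin_central_Fp_eq0 ?mul0r //; lia.
have -> : j.*2.+1%:R = 0 :> 'F_p by rewrite jlt pchar_Fp_0.
by ring.
Qed.

(** Vandermonde: 2 C(2p-1,p-1) = C(2p,p) = sum C(p,j) C(p,p-j), where p^2 divides all but the two
    outer terms, and 2 is invertible modulo p^2. *)
Lemma Babbage (p : nat) (p_pr : prime p) (p_odd : odd p) :
  ((p ^ 2)%N %| 'C(p + p.-1, p.-1)%:Z - 1)%Z.
Proof.
have p0 := prime_gt0 p_pr.
have cop : coprimez (p ^ 2)%N 2.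
  by rewrite coprimezE /= coprimeXl // coprimen2.
rewrite -(Gauss_dvdzr _ cop) mulrBr mulr1.
have -> : 2 * 'C(p + p.-1, p.-1)%:Z = 'C(p + p, p)%:Z.
  have -> : (p + p = (p + p.-1).+1)%N by lia.
  rewrite -[in 'C(_.+1, p)](prednK p0) binS prednK //.
  have -> : 'C(p + p.-1, p) = 'C(p + p.-1, p.-1).
    by rewrite -bin_sub ?leq_addr // addKn.
  lia.
rewrite -binomial.Vandermonde.
rewrite -(big_mkord xpredT (fun j => 'C(p, j) * 'C(p, p - j))%N).
rewrite big_nat_recr //= subnn bin0 binn muln1.
rewrite -{1}(prednK p0) big_nat_recl // bin0 subn0 binn mul1n.
set S := (\sum_(_ <= _ < _) _)%N.
have -> : (1 + S + 1)%N%:Z - 2 = S by lia.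
rewrite dvdzE /= /S big_nat; apply: dvdn_sum => j /andP[_ jp].
by rewrite -mulnn dvdn_mul ?prime_dvd_bin //; lia.
Qed.

(** For k < p-1 each of C(p,k+1) and C(p+k,k) - 1 supplies a factor p; for k = p-1 the first is 1
    and [Babbage] supplies both. *)
Lemma sum_odd_T_mod (p : nat) (p_pr : prime p) (p_odd : odd p) (m : int) :
  ((p ^ 2)%N %| \sum_(0 <= k < p) ('C(p, k.+1) * 'C(p + k, k))%:R * m ^+ k
      - \sum_(0 <= k < p) 'C(p, k.+1)%:R * m ^+ k)%Z.
Proof.
have p0 := prime_gt0 p_pr.
rewrite -sumrB big_nat; apply: (big_ind (fun z : int => ((p ^ 2)%N %| z)%Z)).
- exact: dvdz0.
- by move=> x y; apply: rpredD.
move=> k /andP[_ kp].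
rewrite -mulrBl dvdz_mulr // natrM -[X in _ - X]mulr1 -mulrBr.
case: (ltnP k p.-1) => kp'; last first.
  have -> : k = p.-1 by lia.
  by rewrite dvdz_mull // natz Babbage.
rewrite (_ : (p ^ 2)%N%:Z = p%:Z * p%:Z); last by rewrite -PoszM mulnn.
apply: dvdz_mul.
  by rewrite natz dvdzE /= prime_dvd_bin //; lia.
rewrite -intr_Fp_eq0 // rmorphB rmorph_nat rmorph1 bin_addp_Fp // binn.
by rewrite leqNgt kp addr0 subrr.
Qed.

Lemma mul_sum_bin_pred (R : comPzRingType) (n : nat) (m : R) :
  m * (\sum_(0 <= k < n) 'C(n, k.+1)%:R * m ^+ k) = (m + 1) ^+ n - 1.
Proof.
rewrite [m + 1]addrC -(sum_bin_expr _ n n.+1) // big_nat_recl // bin0 mul1r expr0.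
rewrite addrAC subrr add0r mulr_sumr; apply: eq_bigr => k _.
by rewrite exprS mulrCA.
Qed.

(** * From ['F_p] back to fractions, and the two parts assembled *)

Lemma coprimez_prime (p : nat) (v : int) :
  prime p -> ~~ (p %| v)%Z -> coprimez v p.
Proof. by move=> p_pr; rewrite coprimez_sym coprimezE /= prime_coprime. Qed.

Lemma prime_dvdz_exp (p n : nat) (v : int) :
  prime p -> ~~ (p %| v)%Z -> ~~ (p %| v ^+ n)%Z.
Proof.
by move=> p_pr; rewrite -!intr_Fp_eq0 // rmorphXn /= => v0; rewrite expf_neq0.
Qed.

Lemma ratmod_div_exp (p : nat) (a e u : int) : prime p -> ~~ (p %| u)%Z ->
  a%:~R = e%:~R :> 'F_p -> ratmod p (a%:~R / u%:~R ^+ p.-1) e%:~R.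
Proof.
move=> p_pr pu ae; have p0 := prime_gt0 p_pr.
have u0 : u != 0 by apply: contraNneq pu => ->; rewrite dvdz0.
rewrite -rmorphXn -[e%:~R]divr1 -[1]/(1%:~R) /=.
apply: ratmod_div => //.
- exact: expf_neq0.
- exact/coprimez_prime/prime_dvdz_exp.
- by rewrite coprimezE coprime1n.
rewrite mulr1 -intr_Fp_eq0 // rmorphB rmorphM rmorphXn /= expf_Fp_pred //.
  by rewrite mulr1 ae subrr.
by rewrite intr_Fp_eq0.
Qed.

Lemma sum_div_exp (R : fieldType) (n : nat) (u : R) (F : nat -> R) :
  (0 < n)%N -> u != 0 ->
  \sum_(0 <= k < n) F k / u ^+ k =
  (\sum_(0 <= k < n) F k * u ^+ (n.-1 - k)) / u ^+ n.-1.
Proof.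
case: n => // n _ u0; rewrite mulr_suml !big_nat /=.
apply: eq_bigr => k kn.
rewrite -mulrA; congr (_ * _); apply: (mulIf (expf_neq0 n u0)).
rewrite mulfVK ?expf_neq0 // -{1}(@subnKC k n) // exprD mulrA mulVf ?mul1r //.
exact: expf_neq0.
Qed.

Theorem theorem1p2 (b c d : int) (hd : d = b ^+ 2 - 4 * c) :
  (* (i) *)
  [/\ forall n : nat, (0 < n)%N ->
        (\sum_(0 <= k < n) T k b (c ^+ 2) * (b - 2 * c) ^+ (n - 1 - k)
           = 0 %[mod n])%Z
        /\ (6 * (\sum_(0 <= k < n)
                   k%:R * T k b (c ^+ 2) * (b - 2 * c) ^+ (n - 1 - k))
           = 0 %[mod n])%Z
    & forall p : nat, prime p -> odd p -> ~~ (p %| b - 2 * c)%Z ->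
        ratmod p
          ((2 * c)%:~R / p%:R
             * \sum_(0 <= k < p) (T k b (c ^+ 2))%:~R / (b - 2 * c)%:~R ^+ k)
          (- b + (b + 2 * c) * legendre (b ^+ 2 - 4 * c ^+ 2) p)%:~R
        /\ ratmod p
          ((12 * c ^+ 2)%:~R / p%:R
             * \sum_(0 <= k < p)
                 k%:R * (T k b (c ^+ 2))%:~R / (b - 2 * c)%:~R ^+ k)
          ((b + 2 * c) ^+ 2 * (1 - legendre (b ^+ 2 - 4 * c ^+ 2) p)
             - 4 * c ^+ 2)%:~R]
  /\
  (* (ii) *)
  (d = 1 ->
   exists m : int,
   [/\ b = 2 * m + 1 /\ c = m ^+ 2 + m,
       forall k : nat,
         T k b c = \sum_(0 <= j < k.+1) ('C(k, j) * 'C(k + j, j))%:R * m ^+ j,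
       forall n : nat, (0 < n)%N ->
         let S : rat :=
           n%:R^-1 * \sum_(0 <= k < n) (2 * k + 1)%:R * (T k b c)%:~R in
         S = \sum_(0 <= k < n)
               ('C(n, k.+1) * 'C(n + k, k))%:R * ((b - 1)%:~R / 2) ^+ k
         /\ S \is a Num.int
     & forall p : nat, prime p -> ~~ (p %| b - 1)%Z ->
         [/\ ratmod (p ^ 3)
               (\sum_(0 <= k < p) (2 * k + 1)%:R * (T k b c)%:~R)
               (p%:R + (b + 1)%:~R / (b - 1)%:~R * p%:R
                         * (((b + 1)%:~R / 2) ^+ (p - 1) - 1)),
             ratmod p
               (\sum_(0 <= k < p) ((2 * k + 1) ^ 2)%:R * (T k b c)%:~R)
               (2 / (b - 1)%:~R * (legendre ((1 - b) %/ 2)%Z p)%:~R)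
           & 2 / (b - 1)%:~R * (legendre ((1 - b) %/ 2)%Z p)%:~R
               = m%:~R^-1 * (legendre (- m) p)%:~R :> rat]]).
Proof.
split.
  split.
    move=> [|n] // _; rewrite subn1 /= sum_T_sq sum_mul_T_sq.
    by rewrite natz; split; apply/eqP; rewrite eqz_mod_dvd subr0 dvdz_mulr.
  move=> p p_pr p_odd pu; have p0 := prime_gt0 p_pr.
  have u0 : b - 2 * c != 0 by apply: contraNneq pu => ->; rewrite dvdz0.
  have u1 : (b - 2 * c)%:~R != 0 :> rat by rewrite intr_eq0.
  have p1 : p%:R != 0 :> rat by rewrite pnatr_eq0 -lt0n.
  have uF : (b - 2 * c)%:~R != 0 :> 'F_p by rewrite intr_Fp_eq0.
  have legE : (legendre (b ^+ 2 - 4 * c ^+ 2) p)%:~R =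
     (((b - 2 * c)%:~R + 4 * c%:~R) * (b - 2 * c)%:~R) ^+ p./2 :> 'F_p.
    by rewrite legendre_Euler //; congr (_ ^+ _); ring.
  split.
    pose A := 2 * c * (\sum_(0 <= j < p) ('C(p.-1, j) * catalan j)%:R
                  * (c ^+ j * (b - 2 * c) ^+ (p.-1 - j))).
    rewrite [X in ratmod p X](_ : _ = A%:~R / (b - 2 * c)%:~R ^+ p.-1).
      apply: ratmod_div_exp => //.
      rewrite /A rmorphM rmorph_sum /=.
      under eq_bigr => j _ do rewrite rmorphM rmorph_nat rmorphM !rmorphXn /=.
      rewrite rmorphM /= sum_bin_catalan_Fp // -legE; ring.
    have := sum_T_sq p.-1 b c; rewrite prednK // => E.
    rewrite sum_div_exp //.
    have -> : \sum_(0 <= k < p) (T k b (c ^+ 2))%:~R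
                 * (b - 2 * c)%:~R ^+ (p.-1 - k) =
        (\sum_(0 <= k < p) T k b (c ^+ 2) * (b - 2 * c) ^+ (p.-1 - k))%:~R :> rat.
      by rewrite rmorph_sum; apply: eq_bigr => k _; rewrite rmorphM rmorphXn.
    rewrite E /A !rmorphM /= rmorph_nat; field.
    by rewrite p1 expf_neq0.
  pose A := 2 * c ^+ 2 * (\sum_(0 <= j < p)
     ('C(p.-1, j.+1)%:R * j.+1%:R * central_quo j
        + 6 * j%:R * 'C(p.-1, j)%:R * (catalan j)%:R)
     * (c ^+ j * (b - 2 * c) ^+ (p.-1 - j))).
  rewrite [X in ratmod p X](_ : _ = A%:~R / (b - 2 * c)%:~R ^+ p.-1).
    apply: ratmod_div_exp => //.
    rewrite /A rmorphM rmorph_sum /=.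
    under eq_bigr => j _ do
      rewrite rmorphM rmorphD !rmorphM !rmorph_nat !rmorphXn /=.
    rewrite rmorphM rmorphXn /= sum_bin_central_quo_Fp // -legE; ring.
  have := sum_mul_T_sq p.-1 b c; rewrite prednK // => E.
  rewrite sum_div_exp //.
  have -> : \sum_(0 <= k < p) k%:R * (T k b (c ^+ 2))%:~R
               * (b - 2 * c)%:~R ^+ (p.-1 - k) =
      (\sum_(0 <= k < p) k%:R * T k b (c ^+ 2) * (b - 2 * c) ^+ (p.-1 - k))%:~R
      :> rat.
    rewrite rmorph_sum; apply: eq_bigr => k _.
    by rewrite !rmorphM rmorphXn /= rmorph_nat.
  have {}E := congr1 (fun z : int => z%:~R : rat) E.
  rewrite /= !rmorphM /= !rmorph_nat in E.
  rewrite [(12 * c ^+ 2)%:~R](_ : _ = 2 * c%:~R ^+ 2 * 6); last by ring.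
  rewrite /A rmorphM /= [(2 * c ^+ 2)%:~R](_ : _ = 2 * c%:~R ^+ 2); last by ring.
  move: E; set S1 := (\sum_(_ <= _ < _) _)%:~R; set S2 := _%:~R => E.
  (* Division by 6 takes place in the rationals, so p = 3 is covered as well. *)
  have -> : S1 = p%:R * S2 / 6 by rewrite -E; field.
  by field; rewrite p1 expf_neq0.
move=> d1; rewrite d1 {d d1} in hd.
have [m bE cE] : exists2 m : int, b = 2 * m + 1 & c = m ^+ 2 + m.
  pose m := (b %/ 2)%Z.
  have bm := divz_eq b 2; rewrite -/m in bm.
  (* b is odd: for even b the discriminant b^2 - 4c is a multiple of 4. *)
  have : ((b %% 2)%Z = 0) \/ ((b %% 2)%Z = 1) by lia.
  case=> r; rewrite r in bm; move: hd; rewrite bm => hd.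
    exfalso; move: hd; rewrite (_ : (m * 2 + 0) ^+ 2 = 4 * m ^+ 2); last by ring.
    lia.
  exists m; first by ring.
  move: hd; rewrite (_ : (m * 2 + 1) ^+ 2 = 4 * (m ^+ 2 + m) + 1); last by ring.
  lia.
subst b c => {hd}; exists m; split=> //.
- by move=> k; apply: T_disc1E.
- move=> n n0 S.
  have -> : S = (\sum_(0 <= k < n) ('C(n, k.+1) * 'C(n + k, k))%:R * m ^+ k)%:~R.
    have n1 : n%:R != 0 :> rat by rewrite pnatr_eq0 -lt0n.
    apply: (mulfI n1); rewrite /S mulVKf //.
    transitivity ((\sum_(0 <= k < n) (2 * k + 1)%:R
                    * T k (2 * m + 1) (m ^+ 2 + m))%:~R : rat).
      by rewrite rmorph_sum; apply: eq_bigr => k _; rewrite rmorphM /= rmorph_nat.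
    by rewrite sum_odd_T rmorphM /= rmorph_nat.
  split; last exact: intr_int.
  rewrite rmorph_sum; apply: eq_bigr => k _.
  by rewrite rmorphM rmorphXn /= rmorph_nat; congr (_ * _ ^+ _); field.
move=> p p_pr pb; have p0 := prime_gt0 p_pr.
have bE : 2 * m + 1 - 1 = 2 * m by rewrite addrK.
rewrite bE in pb.
have p_odd : odd p.
  by case: (even_prime p_pr) pb => // ->; rewrite dvdz_mulr.
have pm : ~~ (p %| m)%Z by apply: contraNN pb; apply: dvdz_mull.
have m0 : m != 0 by apply: contraNneq pm => ->; rewrite dvdz0.
have m1 : m%:~R != 0 :> rat by rewrite intr_eq0.
have legE : 2 / (2 * m + 1 - 1)%:~R
     * (legendre ((1 - (2 * m + 1)) %/ 2)%Z p)%:~R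
   = m%:~R^-1 * (legendre (- m) p)%:~R :> rat.
  rewrite bE (_ : 1 - (2 * m + 1) = - m * 2); last by ring.
  by rewrite mulzK // rmorphM /=; field.
split=> //.
- pose Q : int := \sum_(0 <= k < p) 'C(p, k.+1)%:R * m ^+ k.
  have mQ : m%:~R * Q%:~R = (m%:~R + 1) ^+ p - 1 :> rat.
    by rewrite -rmorphM /= mul_sum_bin_pred rmorphB rmorphXn rmorphD.
  rewrite [X in ratmod _ X](_ : _ = (p%:R * \sum_(0 <= k < p)
      ('C(p, k.+1) * 'C(p + k, k))%:R * m ^+ k)%:~R); last first.
    rewrite -sum_odd_T rmorph_sum; apply: eq_bigr => k _.
    by rewrite rmorphM /= rmorph_nat.
  rewrite [X in ratmod _ _ X](_ : _ = (p%:R * Q)%:~R); last first.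
    (* After multiplication by m both sides are p ((m+1)^p - 1), since b+1 = 2(m+1) and b-1 = 2m. *)
    apply: (mulfI m1).
    rewrite rmorphM /= rmorph_nat [RHS]mulrCA mQ bE.
    rewrite [(2 * m + 1 + 1)%:~R / 2](_ : _ = m%:~R + 1); last by field.
    have -> : (m%:~R + 1) ^+ p = (m%:~R + 1) * (m%:~R + 1) ^+ (p - 1) :> rat.
      by rewrite -exprS subn1 prednK.
    by field.
  apply: ratmod_int; first by rewrite expn_gt0 p0.
  (* The outer factor p lifts the congruence modulo p^2 to p^3. *)
  rewrite -mulrBr expnS PoszM natz dvdz_mul //; exact: sum_odd_T_mod.
rewrite legE [m%:~R^-1 * _]mulrC.
rewrite [X in ratmod _ X](_ : _ = (\sum_(0 <= k < p) ((2 * k + 1) ^ 2)%:R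
     * T k (2 * m + 1) (m ^+ 2 + m))%:~R / 1%:~R); last first.
  rewrite divr1 rmorph_sum; apply: eq_bigr => k _.
  by rewrite rmorphM /= rmorph_nat.
apply: ratmod_div => //; [by rewrite coprimezE coprime1n|exact: coprimez_prime|].
rewrite -intr_Fp_eq0 // mulr1 rmorphB rmorphM /= mulrC sum_sqr_odd_T_Fp //.
by rewrite legendre_Euler // subrr.
Qed.
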